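(* For each integer $t\ge 3$ there is a graph $U$ such that: $U$ contains every $K_t$-minor-free graph as an induced subgraph; $U$ contains no subdivision of $K_{\aleph_0}$; $U$ is $(t-1)^2$-colourable; every finite nonempty subgraph of $U$ has a vertex of degree at most $(t-2)(2t-3)$; and $\operatorname{col}_r(U)\le (t-2)(t-1)(2r+1)$ for every $r\in\mathbb{N}$.
   Context: All graphs are simple and countable. For a total order $\preceq$ of $V(G)$, a vertex $v$ and $r\in\mathbb{N}$, $S_r(G,\preceq,v)$ is the set of vertices $w$ for which there is a path $v=w_0,w_1,\dots,w_{r'}=w$ with $0\le r'\le r$, $w\preceq v$, and $v\prec w_i$ for all $1\le i\le r'-1$. The $r$-colouring number $\operatorname{col}_r(G)$ is the minimum over total orders $\preceq$ of $V(G)$ of $\sup_v|S_r(G,\preceq,v)|$. *)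

(* Defs.v *)
From mathcomp Require Import all_boot.
Set Implicit Arguments. Unset Strict Implicit. Unset Printing Implicit Defensive.

Record sgraph := SGraph {
  vert : countType;
  adj : rel vert;
  adj_sym : symmetric adj;
  adj_irr : irreflexive adj }.

Section Defs.
Variable G : sgraph.
Local Notation V := (vert G).
Local Notation E := (@adj G).

Definition connected_set (B : V -> Prop) : Prop :=
  forall x y, B x -> B y ->
    exists p : seq V, [/\ path E x p, last x p = y & forall z, z \in p -> B z].

Definition has_K_minor (t : nat) : Prop :=
  exists B : 'I_t -> V -> Prop,
    [/\ forall i, exists x, B i x,
        forall i, connected_set (B i),
        forall i j x, i != j -> B i x -> ~ B j x &
        forall i j, i != j -> exists x y, [/\ B i x, B j y & E x y] ].

Definition has_subdiv_K_aleph0 : Prop :=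
  exists (b : nat -> V) (P : nat -> nat -> seq V),
    [/\ injective b,
        forall i j, i < j ->
          [/\ path E (b i) (rcons (P i j) (b j)), uniq (P i j) &
              forall z k, z \in P i j -> z <> b k] &
        forall i j k l, i < j -> k < l -> (i, j) <> (k, l) ->
          forall z, z \in P i j -> z \notin P k l ].

Definition colourable (k : nat) : Prop :=
  exists c : V -> 'I_k, forall x y, E x y -> c x != c y.

Definition finite_subgraphs_have_low_degree (d : nat) : Prop :=
  forall (S : seq V) (F : rel V),
    uniq S -> S != [::] -> symmetric F -> (forall x y, F x y -> E x y) ->
    exists2 v, v \in S & size [seq w <- S | F v w] <= d.

Definition total_order (ord : rel V) : Prop :=
  [/\ reflexive ord, antisymmetric ord, transitive ord & total ord].

(* w \in S_r(G, ord, v): there is a path v = w_0, w_1, ..., w_{r'} = w with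
   0 <= r' <= r, w <= v, and v < w_i for all internal vertices 1 <= i <= r'-1.
   Here p = [w_1; ...; w_{r'}]. *)
Definition in_S (ord : rel V) (r : nat) (v w : V) : Prop :=
  exists p : seq V,
    [/\ size p <= r, path E v p, uniq (v :: p), last v p = w &
        ord w v] /\
        (forall z, z \in take (size p).-1 p -> ord v z && (z != v)).

(* col_r(G) <= k: some total order makes every |S_r(G, ord, v)| at most k
   (col_r is a minimum over total orders of a supremum). *)
Definition col_le (r k : nat) : Prop :=
  exists ord : rel V, total_order ord /\
    forall v (s : seq V), uniq s -> (forall w, w \in s -> in_S ord r v w) ->
      size s <= k.

End Defs.

Definition induced_sub (H G : sgraph) : Prop :=
  exists f : vert H -> vert G,
    injective f /\ forall x y, adj (f x) (f y) = adj x y.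

(* Main.v *)
(** Every connected [K_t]-minor-free graph has a chordal partition into finite
    connected parts.  A component [C] of what remains touches pairwise adjacent
    earlier parts, hence at most [t - 2] of them.  The next part is a boundary
    vertex of [C] together with one geodesic for each further touched part, each
    leading, inside [C], from the neighbourhood of that part to the union of the
    geodesics already chosen.  Taking the least boundary vertex in the enumeration
    makes this process exhaust a countable graph.

    All edges join vertices comparable in the resulting tree order, so a vertex
    can be encoded by the sequence of the labels of its predecessors, where a label
    records adjacency, the part, the geodesic and the distances in all earlier
    components.  The universal graph consists of all label sequences; its edges
    join prefixes of sequences that satisfy the constraints that the labels of a
    partition obey.  A walk above a vertex changes each distance by at most one
    per step, and a geodesic has one vertex at each distance: this bounds the
    colouring numbers.  A neighbour on one geodesic forces distance at most one to
    all later geodesics of the same part: this leaves three neighbours on the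
    first geodesic that is met, and two on every later one. *)
Require Import Defs.
From HB Require Import structures.
From mathcomp Require Import all_boot boolp zify.

Set Implicit Arguments. Unset Strict Implicit. Unset Printing Implicit Defensive.

(** * Counting by keys and by windows of values *)

Lemma size_by_key (T K : eqType) (k : T -> K) (ks : seq K) (m : nat) (s : seq T) :
  {in s, forall x, k x \in ks} ->
  (forall q, q \in ks -> size [seq x <- s | k x == q] <= m) ->
  size s <= size ks * m.
Proof.
elim: ks s => [|q ks IH] s sk sm.
  by case: s sk {sm} => // x s /(_ x (mem_head _ _)).
have <- := perm_size (permEl (perm_filterC (fun x => k x == q) s)).
rewrite size_cat /= mulSn leq_add ?sm ?mem_head //; apply: IH => [x|q' q'ks].
  by rewrite mem_filter /= => /andP[kx /sk]; rewrite inE (negPf kx).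
apply: leq_trans (sm q' _); last by rewrite inE q'ks orbT.
by rewrite -filter_predI !size_filter; apply: sub_count => x /= /andP[].
Qed.

Lemma size_by_window (T : eqType) (h : T -> nat) (s : seq T) (lo n : nat) :
  uniq s -> {in s &, injective h} -> {in s, forall x, lo <= h x < lo + n} ->
  size s <= n.
Proof.
move=> us hinj hwin; rewrite -(size_map h) -(size_iota lo n).
apply: uniq_leq_size; first by rewrite map_inj_in_uniq.
by move=> _ /mapP[x xs ->]; rewrite mem_iota hwin.
Qed.

(* [lpath] is 0 at the root of a part and [s] on its [s]-th geodesic; [lrest] counts
   down inside a part, which makes parts finite along every branch; [ldist] holds,
   for each part [j] and each [s], the distance to the first [s] paths of [j]. *)
Record label := Label {
  lid : nat;
  lpart : nat;
  lpath : nat;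
  lrest : nat;
  lcol : nat;
  lprev : seq nat;
  lnbr : seq nat;
  ldist : seq (seq nat) }.

Definition label_code (a : label) :=
  (lid a, lpart a, lpath a, lrest a, lcol a, lprev a, lnbr a, ldist a).
Definition label_decode c :=
  let: (i, p, s, r, k, q, b, d) := c in Label i p s r k q b d.
Lemma label_codeK : cancel label_code label_decode.
Proof. by case. Qed.
HB.instance Definition _ := Countable.copy label (can_type label_codeK).

Definition dist (a : label) (j s : nat) := nth 0 (nth [::] (ldist a) j) s.

(** The position of a vertex on its own geodesic, measured from the preceding paths of its part. At
    a root there are none, and [good_dist] makes the value 0. *)
Definition layer (a : label) := dist a (lpart a) (lpath a).

(** * The universal graph and its prefix order *)

Section Universal.
Variable t : nat.
Hypothesis t3 : 3 <= t.

(** By [good_dist], the distance to the first [s] paths of part [j] vanishes exactly when [s = 0] or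
    the vertex lies on one of them. *)
Record good (a : label) : Prop := Good {
  good_prev : size (lprev a) <= t - 2;
  good_path : lpath a < t - 2;
  good_col : lcol a < t - 1;
  good_dist : forall j s, s < t - 2 -> j <= lpart a ->
    (0 < dist a j s) = (0 < s) && ((j < lpart a) || (s <= lpath a)) }.

(** Here [a] precedes [b] on a branch. [compat_prev] reflects that regions shrink along a branch, so
    a part touched later was touched before; [compat_nbr] that adjacent parts are touched and
    coloured properly; [compat_dist] that distances are 1-Lipschitz along edges. *)
Record compat (a b : label) : Prop := Compat {
  compat_part : lpart a <= lpart b;
  compat_rest : lpart a = lpart b -> lrest b < lrest a;
  compat_layer : lpart a = lpart b -> lpath a = lpath b -> layer a <> layer b;
  compat_prev : forall q, q \in lprev b -> q < lpart a -> q \in lprev a;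
  compat_nbr : lid a \in lnbr b -> lpart a != lpart b ->
    (lpart a \in lprev b) && (lcol a != lcol b);
  compat_dist : lid a \in lnbr b -> forall j s, j <= lpart a ->
    dist a j s <= (dist b j s).+1 /\ dist b j s <= (dist a j s).+1 }.

Definition valid (c : seq label) :=
  all (fun a => `[< good a >]) c && pairwise (fun a b => `[< compat a b >]) c.

Definition tip (u : seq label) := last (Label 0 0 0 0 0 [::] [::] [::]) u.

(** Validity is part of the order, so invalid sequences and the empty one become isolated vertices,
    and all label sequences can serve as vertices. *)
Definition below (u v : seq label) :=
  [&& u != [::], valid v, size u < size v & prefix u v].

Definition up_adj (u v : seq label) := below u v && (lid (tip u) \in lnbr (tip v)).

Definition universal_adj (u v : seq label) := up_adj u v || up_adj v u.

Lemma universal_adj_sym : symmetric universal_adj.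
Proof. by move=> u v; rewrite /universal_adj orbC. Qed.

Lemma universal_adj_irr : irreflexive universal_adj.
Proof. by move=> u; rewrite /universal_adj /up_adj /below ltnn !andbF. Qed.

Definition universal := SGraph universal_adj_sym universal_adj_irr.

Lemma up_adj_below u v : up_adj u v -> below u v. Proof. by case/andP. Qed.

Lemma below_size u v : below u v -> size u < size v. Proof. by case/and4P. Qed.

Lemma below_nil u v : below u v -> u != [::]. Proof. by case/and4P. Qed.

Lemma below_valid u v : below u v -> valid v. Proof. by case/and4P. Qed.

Lemma below_validl u v : below u v -> valid u.
Proof.
case/and4P=> _ /andP[av pv] _ /prefixP[w vE]; rewrite /valid.
by move: av pv; rewrite vE all_cat pairwise_cat => /andP[-> _] /and3P[_ -> _].
Qed.

Lemma below_trans u v w : below u v -> below v w -> below u w.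
Proof.
case/and4P=> u0 _ uv puv /and4P[_ vw svw pvw]; apply/and4P; split=> //.
  exact: ltn_trans svw.
exact: prefix_trans pvw.
Qed.

Lemma tip_mem u : u != [::] -> tip u \in u.
Proof. by case: u => //= a u _; rewrite /tip /= mem_last. Qed.

Lemma valid_good u : u != [::] -> valid u -> good (tip u).
Proof. by move=> u0 /andP[/allP/(_ _ (tip_mem u0))/asboolP]. Qed.

Lemma below_good u v : below u v -> good (tip v).
Proof.
move=> uv; apply: valid_good (below_valid uv).
by case: v uv => // /below_size.
Qed.

Lemma below_goodl u v : below u v -> good (tip u).
Proof. by move=> uv; apply: valid_good (below_nil uv) (below_validl uv). Qed.

Lemma below_compat u v : below u v -> compat (tip u) (tip v).
Proof.
case/and4P=> u0 /andP[_ pv] suv /prefixP[w vE].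
move: pv suv; rewrite vE pairwise_cat => /and3P[/allrelP uw _ _].
rewrite size_cat -[X in X < _]addn0 ltn_add2l lt0n size_eq0 => w0.
apply/asboolP; apply: uw; first exact: tip_mem.
by case: w w0 {vE} => // a w _; rewrite /tip last_cat /= mem_last.
Qed.

Lemma below_size_eq u w v : below u v -> below w v -> size u = size w -> u = w.
Proof.
case/and4P=> _ _ _ puv /and4P[_ _ _ pwv] suw.
by move: puv pwv; rewrite !prefixE suw => /eqP <- /eqP.
Qed.

Lemma below_size_lt u w v :
  below u v -> below w v -> size u < size w -> below u w.
Proof.
move=> uv wv suw; rewrite /below suw (below_nil uv) (below_validl wv) /=.
case/and4P: uv => _ _ _ /prefixP[u' uE]; case/and4P: wv => _ _ _ /prefixP[w' wE].
have := congr1 (take (size u)) uE.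
by rewrite {1}wE take_cat suw take_size_cat // prefixE => ->.
Qed.

(** Two prefixes of [v] are comparable, so [compat_layer] applies to them. *)
Lemma below_layer_inj u w v : below u v -> below w v ->
  lpart (tip u) = lpart (tip w) -> lpath (tip u) = lpath (tip w) ->
  layer (tip u) = layer (tip w) -> u = w.
Proof.
move=> uv wv part_eq path_eq layer_eq.
case: (ltngtP (size u) (size w)) => suw; last exact: below_size_eq uv wv suw.
  by case: (compat_layer (below_compat (below_size_lt uv wv suw)) part_eq path_eq).
by case: (compat_layer (below_compat (below_size_lt wv uv suw))
  (esym part_eq) (esym path_eq)).
Qed.

Lemma up_adj_part u v : up_adj u v -> lpart (tip u) \in lpart (tip v) :: lprev (tip v).
Proof.
case/andP=> /below_compat uv nb; rewrite inE.
by case: eqVneq => //= /(compat_nbr uv nb)/andP[].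
Qed.

(** * Colouring *)

(* On a geodesic only the vertex at distance 1 has neighbours on the earlier ones, so
   it gets a colour of its own and all the other vertices share two colours. *)
Definition local_colour (a : label) :=
  if layer a == 1 then (lpath a).+1 else odd (layer a) : nat.

Lemma good_layer a : good a -> (0 < layer a) = (0 < lpath a).
Proof.
by move=> ga; rewrite (good_dist ga) ?(good_path ga) // ltnn leqnn andbT.
Qed.

Lemma local_colour_lt a : good a -> local_colour a < t - 1.
Proof.
move=> ga; have := good_path ga; rewrite /local_colour.
by case: eqP => _; [|case: (odd _)]; lia.
Qed.

(** The vertex of [a] lies on a path before that of [b], hence has distance 0 to those paths. So [b]
    is in layer 1, and its colour [lpath b + 1] exceeds every colour that occurs on the path of
    [a]. *)
Lemma local_colour_path_lt a b : good a -> good b ->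
  lpart a = lpart b -> lpath a < lpath b ->
  dist b (lpart a) (lpath b) <= (dist a (lpart a) (lpath b)).+1 ->
  local_colour a != local_colour b.
Proof.
move=> ga gb part_eq path_lt.
have a0 : dist a (lpart a) (lpath b) = 0.
  apply/eqP; rewrite -leqn0 leqNgt (good_dist ga) ?(good_path gb) //.
  by rewrite ltnn /= [_ <= lpath a]leqNgt path_lt andbF.
have b0 := good_layer gb; rewrite a0 part_eq -/(layer b) => b1.
rewrite /local_colour (_ : layer b == 1); last by lia.
by case: ifP => _; [|case: (odd _)]; lia.
Qed.

Lemma local_colour_proper a b : good a -> good b -> compat a b ->
  lid a \in lnbr b -> lpart a = lpart b -> local_colour a != local_colour b.
Proof.
move=> ga gb ab nb part_eq; have near := compat_dist ab nb.
case: (ltngtP (lpath a) (lpath b)) => path_ab.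
- by apply: local_colour_path_lt => //; apply: (near _ _ _).2.
- rewrite eq_sym; apply: local_colour_path_lt => //.
  by rewrite -part_eq; apply: (near _ _ _).1.
have ne := compat_layer ab part_eq path_ab.
have [] := near (lpart a) (lpath a) (leqnn _).
rewrite {2 3}part_eq {2 3}path_ab -/(layer a) -/(layer b) => le1 le2.
have b0 := good_layer gb; have a0 := good_layer ga.
(* Neighbours on one path lie in consecutive layers, both positive; layers above 1 alternate in
   parity, and layer 1 has a colour at least 2. *)
rewrite /local_colour; have [e|e] : layer a = (layer b).+1 \/ layer b = (layer a).+1 by lia.
  by rewrite e path_ab /=; case: (layer b) b0 => [|[|n]] //=; rewrite ?negbK; case: (odd n); lia.
by rewrite e -path_ab /=; case: (layer a) a0 => [|[|n]] //=; rewrite ?negbK; case: (odd n); lia.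
Qed.

Lemma up_adj_colour u v : up_adj u v ->
  (lcol (tip u), local_colour (tip u)) != (lcol (tip v), local_colour (tip v)).
Proof.
case/andP=> uv nb; rewrite xpair_eqE negb_and; have cuv := below_compat uv.
case: (eqVneq (lpart (tip u)) (lpart (tip v))) => [part_eq|/(compat_nbr cuv nb)/andP[_ ->] //].
by rewrite (local_colour_proper (below_goodl uv) (below_good uv) cuv) ?orbT.
Qed.

Lemma universal_colourable : colourable universal ((t - 1) ^ 2).
Proof.
have t1 : 0 < t - 1 by lia.
(* The pair of colours is written in base [t - 1]. The reductions matter only at vertices whose last
   label is not good. *)
pose c (v : seq label) :=
  lcol (tip v) %% (t - 1) * (t - 1) + local_colour (tip v) %% (t - 1).
have c_lt v : c v < (t - 1) ^ 2.
  have := ltn_pmod (lcol (tip v)) t1; have := ltn_pmod (local_colour (tip v)) t1.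
  by rewrite /c; nia.
have c_arc u v : up_adj u v -> c u != c v.
  move=> uv; apply: contra (up_adj_colour uv) => /eqP; rewrite /c.
  have gu := below_goodl (up_adj_below uv); have gv := below_good (up_adj_below uv).
  rewrite !modn_small ?good_col ?local_colour_lt // => e; apply/eqP.
  have := congr1 (modn^~ (t - 1)) e; have := congr1 (divn^~ (t - 1)) e.
  rewrite /= !divnMDl // !modnMDl !divn_small ?local_colour_lt // !addn0.
  by rewrite !modn_small ?local_colour_lt // => -> ->.
exists (fun v => Ordinal (c_lt v)) => u v; rewrite -val_eqE /=.
by case/orP=> /c_arc // ; rewrite eq_sym.
Qed.

(** * Degeneracy *)

Lemma near_layer_window (s : seq (seq label)) v q k lo n :
  uniq s -> {in s, forall u, below u v} ->
  {in s, forall u, lpart (tip u) = q /\ lpath (tip u) = k} ->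
  {in s, forall u, lo <= layer (tip u) < lo + n} -> size s <= n.
Proof.
move=> us sv sqk win; apply: (size_by_window (h := fun u => layer (tip u)) us) win.
move=> u w uS wS; have [uq uk] := sqk u uS; have [wq wk] := sqk w wS.
by apply: (below_layer_inj (sv u uS) (sv w wS)); rewrite ?uq ?uk.
Qed.

Lemma indegree_part (s : seq (seq label)) v q :
  uniq s -> {in s, forall u, up_adj u v} -> {in s, forall u, lpart (tip u) = q} ->
  size s <= 2 * (t - 2) - 1.
Proof.
move=> us sv sq.
have dvq u m : u \in s ->
    dist (tip u) q m <= (dist (tip v) q m).+1 /\
    dist (tip v) q m <= (dist (tip u) q m).+1.
  move=> uS; case/andP: (sv u uS) => /below_compat cuv nb.
  by apply: (compat_dist cuv nb); rewrite (sq u uS).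
pose sm m := [seq u <- s | lpath (tip u) < m].
pose sp m := [seq u <- s | lpath (tip u) == m].
have spP m u : u \in sp m -> u \in s /\ lpath (tip u) = m.
  by rewrite mem_filter => /andP[/eqP].
have win m lo n : (forall u, u \in sp m -> lo <= layer (tip u) < lo + n) -> size (sp m) <= n.
  apply: (near_layer_window (v := v) (q := q) (k := m)); first exact: filter_uniq.
    by move=> u /spP[/sv/up_adj_below].
  by move=> u /spP[/sq ? ?].
have layE m u : u \in sp m -> layer (tip u) = dist (tip u) q m.
  by case/spP=> /sq <- <-.
have lay0 m u : u \in sp m -> (0 < layer (tip u)) = (0 < m).
  by case/spP=> /sv/up_adj_below/below_goodl/good_layer -> ->.
have step m : m < t - 2 -> size (sm m.+1) <= 2 * m.+1 - 1.
  elim: m => [|m IH] mt.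
    (* Path 0 has only layer 0, so it contributes at most one neighbour. *)
    have -> : sm 1 = sp 0 by apply: eq_filter => u; rewrite ltnS leqn0.
    apply: (win _ 0) => u u0; have := lay0 _ _ u0; lia.
  have -> : size (sm m.+2) = size (sm m.+1) + size (sp m.+1).
    rewrite !size_filter -count_predUI addnC.
    rewrite (@eq_count _ (predI _ _) pred0) ?count_pred0 => [|u /=].
      by apply: eq_count => u /=; lia.
    by lia.
  have {}IH := IH (ltnW mt).
  (* If no neighbour lies on an earlier path, those on path [m.+1] are in the three layers around
     the distance of [v]. *)
  case E : (sm m.+1) => [|w l].
    suff : size (sp m.+1) <= 3 by rewrite /=; lia.
    apply: (win _ (dist (tip v) q m.+1).-1) => u um.
    by have := dvq u m.+1 (spP _ _ um).1; rewrite (layE _ _ um); lia.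
  (* A neighbour [w] on an earlier path forces distance at most 1 on [v], which leaves layers 1 and
     2. *)
  suff : size (sp m.+1) <= 2 by rewrite -E; lia.
  have /andP[wm wS] : (lpath (tip w) < m.+1) && (w \in s).
    by have := mem_head w l; rewrite -E mem_filter.
  have w0 : dist (tip w) q m.+1 = 0.
    have gw := below_goodl (up_adj_below (sv w wS)).
    have := good_dist gw mt (leqnn _); rewrite (sq w wS) ltnn /=; lia.
  apply: (win _ 1) => u um; have := dvq u m.+1 (spP _ _ um).1.
  have := lay0 _ _ um; have := dvq w m.+1 wS; rewrite (layE _ _ um) w0; lia.
suff -> : s = sm (t - 2).-1.+1.
  by apply: leq_trans (step _ _) _; lia.
rewrite /sm prednK; last by lia.
by apply/esym/all_filterP/allP => u /sv/up_adj_below/below_goodl/good_path.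
Qed.

Lemma indegree (s : seq (seq label)) v :
  uniq s -> {in s, forall u, up_adj u v} -> size s <= (t - 2) * (2 * t - 3).
Proof.
move=> us sv; case: (eqVneq s [::]) => [-> //|s0].
have [u0 /sv/up_adj_below/below_good gv] : exists u0, u0 \in s.
  by case: (s) s0 => // a l _; exists a; apply: mem_head.
have sk : {in s, forall u, lpart (tip u) \in lpart (tip v) :: lprev (tip v)}.
  by move=> u /sv; apply: up_adj_part.
have sz : size s <= (size (lprev (tip v))).+1 * (2 * (t - 2) - 1).
  apply: (size_by_key sk) => q _; apply: (@indegree_part _ v q).
  - exact: filter_uniq.
  - by move=> u; rewrite mem_filter => /andP[_ /sv].
  - by move=> u; rewrite mem_filter => /andP[/eqP].
(* There are at most [t - 1] parts, and [(t - 1) * (2 * t - 5)] is one less than the claimed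
   bound. *)
by have := good_prev gv; move: t3 sz; nia.
Qed.

(** All neighbours of a longest sequence in [S] are proper prefixes of it, so its degree is an
    indegree. *)
Lemma universal_low_degree :
  finite_subgraphs_have_low_degree universal ((t - 2) * (2 * t - 3)).
Proof.
move=> S F uS S0 Fsym Fadj.
have [v vS vmax] : exists2 v, v \in S & {in S, forall w : seq label, size w <= size v}.
  elim: S S0 {uS} => // u [|w S] IH _.
    by exists u => [|w]; rewrite inE // => /eqP ->.
  have [//|v vS vmax] := IH.
  case: (leqP (size u) (size v)) => uv.
    exists v => [|x]; first by rewrite inE vS orbT.
    by rewrite inE => /orP[/eqP -> //|/vmax].
  exists u => [|x]; first exact: mem_head.
  by rewrite inE => /orP[/eqP -> //|/vmax xv]; apply: leq_trans xv (ltnW uv).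
exists v => //; apply: (@indegree _ v); first exact: filter_uniq.
move=> w; rewrite mem_filter => /andP[/Fadj/orP[/up_adj_below/below_size|//]].
by move=> vw /vmax; rewrite leqNgt vw.
Qed.

(** * Colouring numbers *)

(** A linear extension of the prefix order; the enumeration breaks ties between equally long
    sequences. *)
Definition size_order (u v : seq label) :=
  (size u < size v) || (size u == size v) && (pickle u <= pickle v).

Lemma size_order_total : @total_order universal size_order.
Proof.
rewrite /size_order; split.
- by move=> u; rewrite eqxx leqnn orbT.
- move=> u v uv; apply: (pcan_inj pickleK).
  by move: uv; move: (pickle u) (pickle v) => m n; lia.
- move=> v u w; move: (pickle u) (pickle v) (pickle w) => m n p; lia.
- move=> u v; move: (pickle u) (pickle v) => m n; lia.
Qed.

Lemma size_order_le u v : size_order u v -> size u <= size v.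
Proof. by rewrite /size_order; lia. Qed.

Definition weakly_below u v := (u == v) || below u v.

Lemma weakly_below_part u v :
  weakly_below u v -> lpart (tip u) <= lpart (tip v).
Proof. by case/orP=> [/eqP -> //|/below_compat/compat_part]. Qed.

Lemma adj_dist u v j s : universal_adj u v ->
  j <= lpart (tip u) -> j <= lpart (tip v) ->
  dist (tip u) j s <= (dist (tip v) j s).+1.
Proof.
case/orP=> /andP[/below_compat c nb] ju jv.
  exact: (compat_dist c nb s ju).1.
exact: (compat_dist c nb s jv).2.
Qed.

Lemma adj_weakly_below x y v : universal_adj x y -> weakly_below v x ->
  size v <= size y -> weakly_below v y.
Proof.
move=> xy vx vy; case/orP: xy => [/up_adj_below xy|/up_adj_below yx].
  apply/orP; right; case/orP: vx => [/eqP -> //|vx]; exact: below_trans xy.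
case/orP: vx vy => [/eqP ->|vx]; first by rewrite leqNgt (below_size yx).
rewrite leq_eqVlt => /orP[/eqP e|lt]; apply/orP.
  by left; rewrite (below_size_eq vx yx).
by right; apply: below_size_lt yx lt.
Qed.

(** The part of [y] is that of [x] or is touched at [x]. As [y] is weakly below [v] and [v] weakly
    below [x], monotone part numbers and [compat_prev] carry this over to [v]. *)
Lemma adj_exit x y v : universal_adj x y -> weakly_below v x ->
  size y <= size v -> weakly_below y v /\
    lpart (tip y) \in lpart (tip v) :: lprev (tip v).
Proof.
move=> xy vx yv; case/orP: xy => [/up_adj_below xy|yx].
  have := leq_trans (below_size xy) yv; case/orP: vx => [/eqP <-|/below_size vx].
    by rewrite ltnn.
  by rewrite ltnNge (ltnW vx).
have yv' : weakly_below y v.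
  case/orP: vx yv => [/eqP ->|vx]; first by rewrite /weakly_below (up_adj_below yx) orbT.
  rewrite leq_eqVlt => /orP[/eqP e|lt]; apply/orP.
    by left; rewrite (below_size_eq (up_adj_below yx) vx e).
  by right; apply: below_size_lt (up_adj_below yx) vx lt.
split=> //; case/orP: vx => [/eqP ->|vx]; first exact: up_adj_part.
case/orP: yv' => [/eqP ->|yv']; first exact: mem_head.
have := up_adj_part yx; rewrite !inE => /orP[/eqP e|yK].
  have := compat_part (below_compat vx); have := compat_part (below_compat yv').
  by rewrite e; move=> ? ?; apply/orP; left; lia.
have := compat_part (below_compat yv'); rewrite leq_eqVlt => /orP[-> //|lt].
by rewrite (compat_prev (below_compat vx) yK lt) orbT.
Qed.

Lemma path_above v x p :
  path universal_adj x p -> weakly_below v x ->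
  (forall z, z \in p -> size v <= size z) ->
  weakly_below v (last x p) /\
  forall j s, j <= lpart (tip v) ->
    dist (tip x) j s <= dist (tip (last x p)) j s + size p /\
    dist (tip (last x p)) j s <= dist (tip x) j s + size p.
Proof.
elim: p x => [|y p IH] x /=; first by move=> _ vx _; split=> // j s _; lia.
case/andP=> xy yp vx pv.
have vy : weakly_below v y by apply: adj_weakly_below xy vx (pv _ (mem_head _ _)).
have [] := IH y yp vy; first by move=> z zp; apply: pv; rewrite inE zp orbT.
move=> vl dl; split=> // j s jv.
have jx := leq_trans jv (weakly_below_part vx).
have jy := leq_trans jv (weakly_below_part vy).
have := dl j s jv; have := adj_dist s xy jx jy.
rewrite universal_adj_sym in xy; have := adj_dist s xy jy jx; lia.
Qed.

(** Internal vertices are at least as long as [v], so the path stays in the tree above [v] until its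
    last step. *)
Lemma in_S_below r v w : @in_S universal size_order r v w -> w != v ->
  [/\ below w v, lpart (tip w) \in lpart (tip v) :: lprev (tip v) &
    forall j s, j <= lpart (tip w) ->
      dist (tip v) j s <= dist (tip w) j s + r /\
      dist (tip w) j s <= dist (tip v) j s + r].
Proof.
case=> p [[szp pth _ lp wv] inner] wNv.
case/lastP: p szp pth lp inner => [|p y]; first by move=> _ _ /= e; rewrite e eqxx in wNv.
rewrite size_rcons rcons_path last_rcons => szp /andP[pth ly] yE; rewrite yE in ly *.
rewrite /= -cats1 take_size_cat // => inner.
have vv : weakly_below v v by rewrite /weakly_below eqxx.
have [|vl dl] := path_above pth vv; first by move=> z /inner/andP[/size_order_le].
have {}szp : @size (seq label) p < r := szp.
have {}ly : universal_adj (@last (seq label) v p) w := ly.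
have [wv' wK] := adj_exit ly vl (size_order_le wv).
have {}wv' : below w v by case/orP: wv' => // e; rewrite e in wNv.
split=> // j s jw; have jv := leq_trans jw (compat_part (below_compat wv')).
have jl := leq_trans jv (weakly_below_part vl).
have := dl j s jv; have := adj_dist s ly jl jw.
by rewrite universal_adj_sym in ly; have := adj_dist s ly jw jl; lia.
Qed.

Lemma universal_col r : col_le universal r ((t - 2) * (t - 1) * (2 * r + 1)).
Proof.
exists size_order; split=> [|v s us sS]; first exact: size_order_total.
have bound_gt0 : 0 < (t - 2) * (t - 1) * (2 * r + 1) by rewrite !muln_gt0; lia.
(* Nothing lies below an empty or invalid [v], so [v] is then the only member. *)
case vg : ((v != [::]) && valid v); last first.
  apply: leq_trans bound_gt0; rewrite -(size_nseq 1 v); apply: uniq_leq_size => // w wS.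
  rewrite inE; apply: contraFT vg => /(in_S_below (sS w wS))[wv _ _].
  by rewrite (below_valid wv) andbT; case: (v) wv => // /below_size.
have {vg} gv : good (tip v) by case/andP: vg; apply: valid_good.
have sinfo w : w \in s ->
  [/\ weakly_below w v, good (tip w), lpart (tip w) \in lpart (tip v) :: lprev (tip v) &
    forall j k, j <= lpart (tip w) ->
      dist (tip v) j k <= dist (tip w) j k + r /\
      dist (tip w) j k <= dist (tip v) j k + r].
  move=> wS; case: (eqVneq w v) => [->|/(in_S_below (sS w wS))[wv ? ?]].
    by split=> //; rewrite ?/weakly_below ?eqxx ?mem_head // => j k _; lia.
  by split=> //; [rewrite /weakly_below wv orbT | apply: below_goodl wv].
have inj u w : u \in s -> w \in s -> lpart (tip u) = lpart (tip w) ->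
    lpath (tip u) = lpath (tip w) -> layer (tip u) = layer (tip w) -> u = w.
  move=> /sinfo[uv _ _ _] /sinfo[wv _ _ _] e1 e2 e3.
  case/orP: uv wv => [/eqP uv|uv] /orP[/eqP wv|wv]; first by rewrite uv wv.
  - by rewrite -uv in wv; case: (compat_layer (below_compat wv)).
  - by rewrite -wv in uv; case: (compat_layer (below_compat uv)).
  exact: below_layer_inj uv wv e1 e2 e3.
have part_bound q :
    size [seq w <- s | lpart (tip w) == q] <= (t - 2) * (2 * r + 1).
  set sq := filter _ _; rewrite -(size_iota 0 (t - 2)).
  apply: (@size_by_key _ _ (fun w => lpath (tip w))).
    move=> w; rewrite mem_filter => /andP[_ /sinfo[_ gw _ _]].
    by rewrite mem_iota (good_path gw).
  move=> k _; set sk := filter _ _.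
  have skP w : w \in sk -> [/\ w \in s, lpart (tip w) = q & lpath (tip w) = k].
    by rewrite !mem_filter => /and3P[/eqP -> /eqP -> ->].
  apply: (@size_by_window _ (fun w => layer (tip w)) _ (dist (tip v) q k - r)).
  - by rewrite !filter_uniq.
  - by move=> u w /skP[us' uq uk] /skP[ws wq wk]; apply: inj; rewrite ?uq ?uk.
  move=> w /skP[/sinfo[_ _ _ dw] wq wk].
  by have := dw _ k (leqnn _); rewrite /layer wq wk; lia.
(* At most [t - 1] parts, [t - 2] paths in each, and [2 * r + 1] layers on each path. *)
have := @size_by_key _ _ (fun w => lpart (tip w)) (lpart (tip v) :: lprev (tip v))
  ((t - 2) * (2 * r + 1)) s.
move=> /(_ (fun w ws => let: And4 _ _ h _ := sinfo w ws in h) (fun q _ => part_bound q)) /=.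
have := good_prev gv; move: (size s) (size (lprev (tip v))) => m n nt.
suff : n.+1 * ((t - 2) * (2 * r + 1)) <= (t - 2) * (t - 1) * (2 * r + 1) by lia.
by rewrite mulnA leq_mul2r [n.+1 * _]mulnC leq_mul2l; apply/orP; right; apply/orP; right; lia.
Qed.

(** * Subdivisions of the countably infinite complete graph *)

Lemma path_crossing (T : eqType) (e : rel T) (D : pred T) x p :
  path e x p -> D x != D (last x p) ->
  exists u w, [/\ u \in belast x p, w \in p, e u w, D u = D x & D w = D (last x p)].
Proof.
elim: p x => [|y p IH] x /=; first by rewrite eqxx.
case/andP=> xy yp Dxl; case: (eqVneq (D x) (D y)) => [Dxy|Dxy].
  have [] := IH y yp; first by rewrite -Dxy.
  move=> u [w [ub wp uw Du Dw]]; exists u, w; split=> //; rewrite ?inE ?ub ?wp ?orbT //.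
  by rewrite Du Dxy.
exists x, y; split; rewrite ?mem_head //.
by move: Dxl Dxy; case: (D x); case: (D y); case: (D _).
Qed.

(** Finiteness of [A], as a bound on its duplicate-free lists. *)
Definition bounded (A : pred nat) :=
  exists n, forall ks, uniq ks -> all A ks -> size ks <= n.

Lemma boundedU (A B : pred nat) : bounded A -> bounded B -> bounded (predU A B).
Proof.
case=> m Am [n Bn]; exists (m + n) => ks uks /allP ABks.
rewrite -(perm_size (permEl (perm_filterC A ks))) size_cat leq_add //.
  by rewrite Am ?filter_uniq ?filter_all.
rewrite Bn ?filter_uniq //; apply/allP => k.
by rewrite mem_filter => /andP[/= /negPf Ak /ABks]; rewrite /= Ak.
Qed.

Lemma bounded_sub (A B : pred nat) : subpred A B -> bounded B -> bounded A.
Proof. by move=> AB [n Bn]; exists n => ks uks /(sub_all AB); apply: Bn. Qed.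

Lemma bounded_cofinite (A : pred nat) : bounded A -> exists k, ~~ A k.
Proof.
case=> n An; have /allPn[k _ Ak] : ~~ all A (iota 0 n.+1).
  by apply/negP => /(An _ (iota_uniq _ _)); rewrite size_iota ltnn.
by exists k.
Qed.

Section Subdivision.
Variables (b : nat -> seq label) (P : nat -> nat -> seq (seq label)).
Hypothesis b_inj : injective b.
Hypothesis P_path : forall i j, i < j -> path universal_adj (b i) (rcons (P i j) (b j)).
Hypothesis P_disj : forall i j k l, i < j -> k < l -> (i, j) <> (k, l) ->
  forall z, z \in P i j -> z \notin P k l.

Let inner i k := if i < k then P i k else P k i.

Lemma bounded_mem (X : seq (seq label)) : bounded (fun k => b k \in X).
Proof.
exists (size X) => ks uks /allP ksX; rewrite -(size_map b).
by apply: uniq_leq_size => [|_ /mapP[k /ksX ? ->] //]; rewrite map_inj_uniq.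
Qed.

(* Menger in its trivial direction: the paths from [b i] into [D] meet the
   separator [X] in distinct vertices. *)
Lemma bounded_separated (D : pred (seq label)) (X : seq (seq label)) i :
  (forall u w, universal_adj u w -> D u -> ~~ D w -> w \in X) ->
  ~~ D (b i) -> b i \notin X -> bounded (fun k => D (b k)).
Proof.
move=> DX Di Xi.
have hit k : D (b k) -> has (mem X) (inner i k).
  move=> Dk; apply/hasP; rewrite /inner; case: (ltngtP i k) => ik.
  - have [] := path_crossing (D := D) (P_path ik).
      by rewrite last_rcons Dk (negPf Di).
    rewrite last_rcons belast_rcons => u [w [uP _ uw Du Dw]].
    have uX : u \in X by apply: (DX w); rewrite ?Dw ?Du // universal_adj_sym.
    exists u => //; move: uP; rewrite inE => /orP[/eqP uE|//].
    by rewrite -uE uX in Xi.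
  - have [] := path_crossing (D := D) (P_path ik).
      by rewrite last_rcons Dk (negPf Di).
    rewrite last_rcons belast_rcons => u [w [_ wP uw Du Dw]].
    have wX : w \in X by apply: (DX u); rewrite ?Dw ?Du.
    exists w => //; move: wP; rewrite mem_rcons inE => /orP[/eqP wE|//].
    by rewrite -wE wX in Xi.
  by rewrite -ik (negPf Di) in Dk.
pose z k := nth [::] (inner i k) (find (mem X) (inner i k)).
have zX k : D (b k) -> z k \in X by move=> /hit /(nth_find [::]).
have zI k : D (b k) -> z k \in inner i k by move=> /hit; rewrite has_find; apply: mem_nth.
exists (size X) => ks uks /allP ksD; rewrite -(size_map z).
apply: uniq_leq_size => [|_ /mapP[k /ksD/zX ? ->] //].
rewrite map_inj_in_uniq // => k l /ksD Dk /ksD Dl zkl.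
have := zI k Dk; have := zI l Dl; rewrite zkl /inner.
have ne j : D (b j) -> j != i by apply: contraTneq => ->.
have := ne k Dk; have := ne l Dl; case: (eqVneq k l) => // kl.
case: (ltngtP i k) => // ik; case: (ltngtP i l) => // il _ _ zl zk;
  by case/negP: (P_disj il ik (fun e => ltac:(case: e; lia)) zl).
Qed.

Definition prefixes (v : seq label) := [seq take n v | n <- iota 0 (size v)].

Lemma below_prefixes u v : below u v -> u \in prefixes v.
Proof.
case/and4P=> _ _ suv; rewrite prefixE => /eqP uE.
by apply/mapP; exists (size u); rewrite ?mem_iota.
Qed.

Lemma prefixes_self v : v \notin prefixes v.
Proof.
apply/mapP => -[n]; rewrite mem_iota /= => nv /(congr1 size).
by rewrite size_take nv => vn; rewrite vn ltnn in nv.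
Qed.

Lemma leave_desc v u w : universal_adj u w ->
  weakly_below v u -> ~~ weakly_below v w ->
  below w v /\ lpart (tip w) \in lpart (tip v) :: lprev (tip v).
Proof.
move=> uw vu vw; have wv : size w <= size v.
  by rewrite leqNgt; apply: contra vw => /ltnW; apply: adj_weakly_below uw vu.
have [/orP[/eqP wE|//] _] := adj_exit uw vu wv.
by rewrite wE /weakly_below eqxx in vw.
Qed.

(** The tree above [b i] is joined to the rest only through the finitely many proper prefixes of
    [b i], which cannot separate [b i] from infinitely many branch vertices. *)
Lemma desc_cofinite i : bounded (fun k => ~~ weakly_below (b i) (b k)).
Proof.
pose D v := ~~ weakly_below (b i) v && (v \notin prefixes (b i)).
have DX u w : universal_adj u w -> D u -> ~~ D w -> w \in prefixes (b i).
  move=> uw /andP[Nu uX]; rewrite negb_and !negbK => /orP[Dw|//].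
  rewrite universal_adj_sym in uw; have [/below_prefixes] := leave_desc uw Dw Nu.
  by rewrite (negPf uX).
have Di : ~~ D (b i) by rewrite /D /weakly_below eqxx.
have := boundedU (bounded_separated DX Di (prefixes_self _)) (bounded_mem (prefixes (b i))).
by apply: bounded_sub => k /= Nk; rewrite /D Nk; case: (_ \in _).
Qed.

(** Some [b k] lies weakly above both, and prefixes of one sequence are comparable. *)
Lemma branch_comparable i j : weakly_below (b i) (b j) || weakly_below (b j) (b i).
Proof.
have [k] := bounded_cofinite (boundedU (desc_cofinite i) (desc_cofinite j)).
rewrite /= negb_or !negbK /weakly_below => /andP[/orP[/eqP ->|ik] /orP[/eqP ->|jk]].
- by rewrite eqxx.
- by rewrite jk !orbT.
- by rewrite ik !orbT.
case: (ltngtP (size (b i)) (size (b j))) => sij.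
- by rewrite (below_size_lt ik jk sij) orbT.
- by rewrite (below_size_lt jk ik sij) !orbT.
- by rewrite (below_size_eq ik jk sij) eqxx.
Qed.

(** Edges leaving the tree above [b m] end in proper prefixes of [b m] in its own part or a touched
    one. Were the part of [b i] not among these, this finite set would separate [b i] from almost
    all branch vertices. *)
Lemma branch_part_prev i m : below (b i) (b m) ->
  lpart (tip (b i)) < lpart (tip (b m)) -> lpart (tip (b i)) \in lprev (tip (b m)).
Proof.
move=> im part_lt; apply/negPn/negP => NK.
pose X := [seq z <- prefixes (b m) | lpart (tip z) \in lpart (tip (b m)) :: lprev (tip (b m))].
have DX u w : universal_adj u w -> weakly_below (b m) u -> ~~ weakly_below (b m) w -> w \in X.
  move=> uw mu mw; have [/below_prefixes wm wK] := leave_desc uw mu mw.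
  by rewrite mem_filter wK.
have Di : ~~ weakly_below (b m) (b i).
  rewrite /weakly_below negb_or; have := below_size im => lt_im; apply/andP; split.
    by apply: contraTneq lt_im => ->; rewrite ltnn.
  by apply: contraTN lt_im => /below_size; rewrite -leqNgt => /ltnW.
have Xi : b i \notin X.
  by rewrite mem_filter negb_and inE negb_or (ltn_eqF part_lt) NK.
have [k] := bounded_cofinite (boundedU (bounded_separated DX Di Xi) (desc_cofinite m)).
by rewrite /=; case: weakly_below.
Qed.

(** Almost all branch vertices lie above [b i], but [lrest] drops strictly within a part, so only
    finitely many of them share the part of [b i]. *)
Lemma branch_part_unbounded i :
  exists2 m, below (b i) (b m) & lpart (tip (b i)) < lpart (tip (b m)).
Proof.
apply: contrapT => none.
have same m : below (b i) (b m) -> lpart (tip (b m)) = lpart (tip (b i)).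
  move=> im; apply/eqP; rewrite eqn_leq (compat_part (below_compat im)) andbT.
  by rewrite leqNgt; apply/negP => lt; apply: none; exists m.
have : bounded (fun k => below (b i) (b k)).
  exists (lrest (tip (b i))) => ks uks /allP ksi.
  apply: (@size_by_window _ (fun k => lrest (tip (b k))) _ 0) => //.
    move=> k l /ksi/same pk /ksi/same pl rest_eq; apply: b_inj.
    have := branch_comparable k l; rewrite /weakly_below.
    case/orP=> /orP[/eqP // |/below_compat/compat_rest]; rewrite pk pl rest_eq ltnn.
      by move/(_ erefl).
    by move/(_ erefl).
  move=> k /ksi ik /=; have := compat_rest (below_compat ik).
  by rewrite same // => /(_ erefl).
move/boundedU => /(_ _ (boundedU (bounded_mem [:: b i]) (desc_cofinite i))).
case/bounded_cofinite=> k /=; rewrite inE /weakly_below eq_sym.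
by case: (_ == _); case: below.
Qed.

(** Climbing through the parts yields a branch vertex with [t - 1] distinct parts in [lprev], one
    more than a good label allows. *)
Lemma no_branch_sequence : False.
Proof.
have chain n : exists s m, [/\ size s = n, uniq [seq lpart (tip (b k)) | k <- s] &
    {in s, forall k, below (b k) (b m) /\ lpart (tip (b k)) < lpart (tip (b m))}].
  elim: n => [|n [s [m [sz us sm]]]]; first by exists [::], 0.
  have [m' mm' lt] := branch_part_unbounded m.
  exists (m :: s), m'; split; rewrite /= ?sz // ?us ?andbT.
    by apply/mapP => -[k /sm[_ lt'] e]; rewrite e ltnn in lt'.
  move=> k; rewrite inE => /orP[/eqP -> //|/sm[km lt']].
  by split; [apply: below_trans mm' | apply: ltn_trans lt].
have [s [m [sz us sm]]] := chain (t - 1).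
have s0 : 0 < size s by lia.
have gm : good (tip (b m)).
  by case: (s) s0 sm => // k s' _ /(_ _ (mem_head _ _))[/below_good].
have : size [seq lpart (tip (b k)) | k <- s] <= size (lprev (tip (b m))).
  by apply: uniq_leq_size => // _ /mapP[k /sm[km lt] ->]; apply: branch_part_prev.
by have := good_prev gm; rewrite size_map sz; lia.
Qed.

End Subdivision.

Lemma universal_no_subdivision : ~ has_subdiv_K_aleph0 universal.
Proof.
case=> b [P [b_inj P_path P_disj]].
by apply: (@no_branch_sequence b P) => // i j /P_path[].
Qed.

End Universal.

(** * Geodesics in connected vertex sets *)

Section Graph.
Variable G : sgraph.
Local Notation V := (vert G).
Local Notation E := (@adj G).
Implicit Types (A B C : pred V) (u v w x y z : V).

Definition reach (A : pred V) (x y : V) : Prop :=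
  exists p, [/\ path E x p, last x p = y & all A (x :: p)].

Lemma reach_refl A x : A x -> reach A x x.
Proof. by move=> Ax; exists [::]; rewrite /= Ax. Qed.

Lemma reach_mem A x y : reach A x y -> A x /\ A y.
Proof.
case=> p [_ <- /allP Ap]; split; first exact: Ap (mem_head _ _).
exact: Ap (mem_last _ _).
Qed.

Lemma reach_trans A x y z : reach A x y -> reach A y z -> reach A x z.
Proof.
case=> p [pp <- Ap] [q [pq <- Aq]]; exists (p ++ q).
rewrite cat_path pp pq last_cat; split=> //; move: Ap Aq.
by rewrite /= all_cat => /andP[-> ->] /andP[_ ->].
Qed.

Lemma reach_edge (A : pred V) x y : A x -> A y -> E x y -> reach A x y.
Proof. by move=> Ax Ay xy; exists [:: y]; rewrite /= Ax Ay xy. Qed.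

Lemma reach_sym A x y : reach A x y -> reach A y x.
Proof.
case=> p [pp <- Ap]; exists (rev (belast x p)); split.
- by rewrite rev_path (eq_path (e' := E)) // => u w; rewrite adj_sym.
- by case: p {pp Ap} => //= z p; rewrite rev_cons last_rcons.
by rewrite -rev_rcons -lastI all_rev.
Qed.

Lemma reach_sub (A B : pred V) x y : subpred A B -> reach A x y -> reach B x y.
Proof. by move=> AB [p [? ? /(sub_all AB)]]; exists p. Qed.

Definition component (A : pred V) (v : V) : pred V := fun x => `[< reach A v x >].

Lemma component_refl (A : pred V) v : A v -> component A v v.
Proof. by move=> Av; apply/asboolP/reach_refl. Qed.

Lemma component_sub A v : subpred (component A v) A.
Proof. by move=> x /asboolP/reach_mem[]. Qed.

Lemma component_edge (A : pred V) v x y : component A v x -> A y -> E x y -> component A v y.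
Proof.
move=> vx Ay xy; apply/asboolP; apply: reach_trans (asboolW vx) _.
exact: reach_edge (component_sub vx) Ay xy.
Qed.

Lemma component_eq A v x : component A v x -> component A x = component A v.
Proof.
move=> /asboolP vx; apply/funext => y; apply/asboolP/asboolP; first exact: reach_trans.
exact: reach_trans (reach_sym vx).
Qed.

Definition conn (A : pred V) := forall x y, A x -> A y -> reach A x y.

Lemma component_conn A v : conn (component A v).
Proof.
move=> x y vx; rewrite -(component_eq vx) => /asboolP[p [pp py Ap]].
exists p; split=> //; apply/allP.
elim/last_ind: p pp Ap {py} => [|p z IH] pp Ap w.
  rewrite inE => /eqP ->; apply: component_refl; exact: component_sub vx.
move: pp Ap; rewrite -rcons_cons all_rcons rcons_path => /andP[pp lz] /andP[Az Ap].
rewrite mem_rcons inE => /orP[/eqP ->|]; last exact: IH.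
by apply: component_edge Az lz; apply: IH => //; apply: mem_last.
Qed.

Lemma conn_add (A : pred V) x y : conn A -> A y -> E x y ->
  conn (fun z => (z == x) || A z).
Proof.
move=> cA Ay xy; set B := (fun z => _).
have AB : subpred A B by move=> z Az; rewrite /B Az orbT.
have Bx : B x by rewrite /B eqxx.
have toy z : B z -> reach B z y.
  case/orP=> [/eqP ->|Az]; first by apply: reach_edge => //; apply: AB.
  by apply: reach_sub AB _; apply: cA.
by move=> u w /toy uy /toy wy; apply: reach_trans uy (reach_sym wy).
Qed.

Lemma conn_connected_set A : conn A -> connected_set (fun x => A x).
Proof.
move=> cA x y Ax Ay; have [p [pp py /= /andP[_ /allP Ap]]] := cA x y Ax Ay.
by exists p.
Qed.

Definition touches (A : pred V) (X : seq V) : bool :=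
  `[< exists x y, [/\ A x, y \in X & E x y] >].

Lemma touches_sub (A B : pred V) X : subpred A B -> touches A X -> touches B X.
Proof. by move=> AB /asboolP[x [y [/AB ? ? ?]]]; apply/asboolP; exists x, y. Qed.

Section Distance.
Variables (A : pred V) (X : seq V).

(** A walk of exactly [n] steps inside [A] from [x] to [X]. *)
Fixpoint near n (x : V) : bool :=
  A x && if n is m.+1 then `[< exists2 y, E x y & near m y >] else x \in X.

(* The distance to [X] inside [A], with junk value 0 when [X] cannot be reached. *)
Definition gdist x : nat :=
  if pselect (exists n, near n x) is left h then ex_minn h else 0.

Lemma gdist_near n x : near n x -> near (gdist x) x /\ gdist x <= n.
Proof.
move=> xn; rewrite /gdist; case: pselect => [h|[]]; last by exists n.
by case: ex_minnP => m mx min; split=> //; apply: min.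
Qed.

Lemma reach_near x y : reach A x y -> y \in X -> exists n, near n x.
Proof.
case=> p [+ + +] yX; elim: p x => [|z p IH] x /=.
  by move=> _ -> /andP[Ay _]; exists 0; rewrite /= Ay.
case/andP=> xz /IH{}IH /IH{}IH /andP[Ax /IH[n zn]].
by exists n.+1; rewrite /= Ax; apply/asboolP; exists z.
Qed.

Lemma near_edge n x y : A x -> E x y -> near n y -> near n.+1 x.
Proof. by move=> Ax xy yn; rewrite /= Ax; apply/asboolP; exists y. Qed.

Lemma gdist_lipschitz x y : A x -> A y -> E x y -> gdist x <= (gdist y).+1.
Proof.
move=> Ax Ay xy; rewrite {1}/gdist; case: pselect => // h.
case: ex_minnP => m xm min; apply: min; apply: near_edge (xy) _ => //.
have yx : E y x by rewrite adj_sym.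
by have [] := gdist_near (near_edge Ay yx xm).
Qed.

Hypothesis connA : conn A.
Hypothesis XA : {subset X <= A}.
Hypothesis X0 : X != [::].

Lemma near_ex x : A x -> exists n, near n x.
Proof.
move=> Ax; case: X X0 XA (@reach_near x) => // y Y _ YA /(_ y); apply.
  by apply: connA => //; apply: YA; apply: mem_head.
exact: mem_head.
Qed.

Lemma gdist_eq0 x : A x -> (gdist x == 0) = (x \in X).
Proof.
move=> Ax; have [n /gdist_near[xd _]] := near_ex Ax.
apply/eqP/idP => [d0|xX]; first by move: xd; rewrite d0 /= Ax.
have x0 : near 0 x by rewrite /= Ax.
by have [_] := gdist_near x0; rewrite leqn0 => /eqP.
Qed.

Lemma gdist_descend x d : A x -> gdist x = d.+1 ->
  exists y, [/\ A y, E x y & gdist y = d].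
Proof.
move=> Ax xd; have [n /gdist_near[+ _]] := near_ex Ax.
rewrite xd /= Ax /= => /asboolP[y xy yd]; exists y.
have Ay : A y by case: (d) yd => [|m] /= /andP[].
split=> //; apply/eqP; rewrite eqn_leq; have [_ ->] := gdist_near yd.
by have := gdist_lipschitz Ax Ay xy; rewrite xd ltnS => ->.
Qed.

Lemma geodesic x : A x -> conn (fun z => z \in X) ->
  exists P, [/\ uniq P, {subset P <= A}, {in P, forall y, 0 < gdist y},
    {in P &, injective gdist} & conn (fun z => z \in X ++ P) /\ x \in X ++ P].
Proof.
move=> Ax cX.
(* The upper bound [gdist x] carries the induction: a new start is strictly farther away than the
   path already built. *)
suff [P [? ? ? Pd ?]] : exists P, [/\ uniq P, {subset P <= A},
    {in P &, injective gdist}, {in P, forall y, 0 < gdist y <= gdist x} &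
    conn (fun z => z \in X ++ P) /\ x \in X ++ P].
  by exists P; split=> // y /Pd/andP[].
move: {2}(gdist x) (erefl (gdist x)) => d; elim: d x Ax => [|d IH] x Ax xd.
  exists [::]; rewrite cats0; do 2!split=> //.
  by rewrite -gdist_eq0 // xd.
have [y [Ay xy yd]] := gdist_descend Ax xd.
have [P [uP PA Pinj Pd [cP yP]]] := IH y Ay yd.
have xP : x \notin P by apply/negP => /Pd; rewrite xd yd ltnn andbF.
exists (x :: P); split.
- by rewrite /= xP.
- by move=> z; rewrite inE => /orP[/eqP ->|/PA].
- move=> u w; rewrite !inE => /orP[/eqP ->|uP'] /orP[/eqP ->|wP'] //; last exact: Pinj.
    by have := Pd w wP'; rewrite xd yd => ? ?; lia.
  by have := Pd u uP'; rewrite xd yd => ? ?; lia.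
- move=> z; rewrite inE => /orP[/eqP ->|/Pd]; first by rewrite xd leqnn.
  by rewrite xd yd; lia.
split; last by rewrite mem_cat mem_head orbT.
have := conn_add cP yP xy; congr conn; apply/funext => z.
by rewrite !mem_cat inE orbCA.
Qed.

End Distance.

Lemma gdist_nil A x : gdist A [::] x = 0.
Proof.
rewrite /gdist; case: pselect => // -[n xn]; exfalso.
elim: n x xn => [|n IH] x /=; first by rewrite andbF.
by case/andP=> _ /asboolP[y _ /IH].
Qed.

(** * One part of the decomposition *)

(** [layered_inj] is all that is kept of the geodesics. At [s = 0] all distances are 0, so it makes
    the first path a single vertex. *)
Record layered (C : pred V) (Q : seq (seq V)) : Prop := Layered {
  layered_neq0 : head [::] Q != [::];
  layered_uniq : uniq (flatten Q);
  layered_sub : {subset flatten Q <= C};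
  layered_conn : conn (fun x => x \in flatten Q);
  layered_inj : forall s x y, x \in nth [::] Q s -> y \in nth [::] Q s ->
    gdist C (flatten (take s Q)) x = gdist C (flatten (take s Q)) y -> x = y }.

Lemma layered_take_neq0 C Q s : layered C Q -> 0 < s -> flatten (take s Q) != [::].
Proof. by move=> /layered_neq0; case: Q s => [|[|x P] Q] [|s]. Qed.

Lemma layered_extend C Q T : conn C -> layered C Q -> touches C T ->
  exists P, layered C (rcons Q P) /\ touches (fun x => x \in flatten (rcons Q P)) T.
Proof.
move=> cC lQ /asboolP[x [y [Cx yT xy]]].
have Q0 : flatten Q != [::] by case: Q {lQ} (layered_neq0 lQ) => [|[|]].
have [P [uP PC Pd Pinj [cP xP]]] := geodesic cC (layered_sub lQ) Q0 Cx (layered_conn lQ).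
have fE : flatten (rcons Q P) = flatten Q ++ P by rewrite flatten_rcons.
exists P; rewrite fE; split; last by apply/asboolP; exists x, y.
split; rewrite ?fE //.
- by have := layered_neq0 lQ; case: (Q).
- rewrite cat_uniq (layered_uniq lQ) uP andbT; apply/hasPn => z zP.
  rewrite -(gdist_eq0 cC (layered_sub lQ) Q0); last exact: PC.
  by rewrite -lt0n Pd.
- by move=> z; rewrite mem_cat => /orP[/(layered_sub lQ)|/PC].
move=> s u w; rewrite nth_rcons -cats1 take_cat.
case: ltngtP => ss; [exact: (layered_inj lQ)|by rewrite in_nil|].
by rewrite ss subnn take0 cats0; apply: Pinj.
Qed.

(** The root is next to one member of [Ts], so one geodesic for each other member suffices; the
    maximum with 1 covers empty [Ts]. *)
Record good_part (C : pred V) (Ts : seq (seq V)) (Q : seq (seq V)) : Prop := GoodPart {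
  part_layered : layered C Q;
  part_size : size Q <= maxn 1 (size Ts);
  part_touches : forall T, T \in Ts -> touches (fun x => x \in flatten Q) T;
  part_least : forall x T, T \in Ts -> C x -> touches (pred1 x) T ->
    exists2 z, z \in flatten Q & pickle z <= pickle x }.

Lemma layered_root C r : C r -> layered C [:: [:: r]].
Proof.
move=> Cr; split=> //=.
- by move=> x; rewrite inE => /eqP ->.
- move=> x y; rewrite !inE => /eqP -> /eqP ->; apply: reach_refl.
  by rewrite inE.
by move=> [|s] x y; rewrite /= ?nth_nil ?inE // => /eqP -> /eqP ->.
Qed.

Lemma layered_extends C Q Ts : conn C -> layered C Q ->
  (forall T, T \in Ts -> touches C T) ->
  exists Q', [/\ layered C Q', size Q' <= size Q + size Ts,
    {subset flatten Q <= flatten Q'} &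
    forall T, T \in Ts -> touches (fun x => x \in flatten Q') T].
Proof.
move=> cC; elim: Ts Q => [|T Ts IH] Q lQ TsC; first by exists Q; split; rewrite ?addn0.
have [P [lP TP]] := layered_extend cC lQ (TsC T (mem_head _ _)).
have [|Q' [lQ' sQ' PQ' TsQ']] := IH _ lP.
  by move=> T' T'Ts; apply: TsC; rewrite inE T'Ts orbT.
exists Q'; split=> //.
- by move: sQ'; rewrite size_rcons /=; lia.
- by move=> x xQ; apply: PQ'; rewrite flatten_rcons mem_cat xQ.
by move=> T'; rewrite inE => /orP[/eqP ->|/TsQ' //]; apply: touches_sub TP.
Qed.

Lemma good_part_ex C Ts v : conn C -> C v -> (forall T, T \in Ts -> touches C T) ->
  exists Q, good_part C Ts Q.
Proof.
move=> cC Cv TsC; case: (eqVneq Ts [::]) => [->|Ts0].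
  by exists [:: [:: v]]; split=> //; apply: layered_root.
pose bd n := `[< exists x T, [/\ pickle x = n, C x, T \in Ts & touches (pred1 x) T] >].
have bd_ex : exists n, bd n.
  case: Ts TsC Ts0 @bd => // T Ts' /(_ _ (mem_head _ _))/asboolP[x [y [Cx yT xy]]] _ bd.
  exists (pickle x); apply/asboolP; exists x, T; rewrite mem_head; split=> //.
  by apply/asboolP; exists x, y; rewrite /= eqxx.
have [n /asboolP[r [T0 [rn Cr T0Ts rT0]]] least] := ex_minnP bd_ex.
(* [T0] is dropped because the least boundary vertex [r] already touches it. *)
have [|Q [lQ sQ rQ TsQ]] := @layered_extends C _ (rem T0 Ts) cC (layered_root Cr).
  by move=> T /mem_rem/TsC.
have {}rQ : r \in flatten Q by apply: rQ; rewrite mem_head.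
exists Q; split=> //.
- by move: sQ; rewrite size_rem //=; case: (size Ts) => [|k] /=; lia.
- move=> T TTs; case: (eqVneq T T0) => [->|TT0].
    by apply: touches_sub rT0 => x /eqP ->.
  by apply: TsQ; rewrite (perm_mem (perm_to_rem T0Ts)) inE (negPf TT0) in TTs.
move=> x T TTs Cx xT; exists r => //; rewrite rn; apply: least.
by apply/asboolP; exists x, T.
Qed.

Definition pick_part C Ts : seq (seq V) :=
  if pselect (exists Q, good_part C Ts Q) is left h then projT1 (cid h) else [::].

Lemma pick_partP C Ts v : conn C -> C v -> (forall T, T \in Ts -> touches C T) ->
  good_part C Ts (pick_part C Ts).
Proof.
move=> cC Cv TsC; rewrite /pick_part; case: pselect => [h|[]]; first by case: cid.
exact: good_part_ex Cv TsC.
Qed.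

End Graph.

(** * Greedy choice of colours *)

Definition fresh (used : seq nat) := find (fun c => c \notin used) (iota 0 (size used).+1).

Lemma fresh_le used : fresh used <= size used /\ fresh used \notin used.
Proof.
have h : has (fun c => c \notin used) (iota 0 (size used).+1).
  apply/negPn/negP => /hasPn sub.
  have : size (iota 0 (size used).+1) <= size used.
    by apply: uniq_leq_size (iota_uniq _ _) _ => c /sub /negPn.
  by rewrite size_iota ltnn.
have := h; rewrite has_find size_iota => lt; split=> //.
by have := nth_find 0 h; rewrite nth_iota.
Qed.

(** * The decomposition *)

Section Decomposition.
Variable G : sgraph.
Local Notation V := (vert G).
Local Notation E := (@adj G).
Implicit Types (A B C : pred V) (u v w x y z : V).

Record state := State {
  parts : seq (seq (seq V));
  colours : seq nat;
  region : pred V }.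

Definition touched (st : state) : seq nat :=
  [seq j <- iota 0 (size (parts st)) |
    touches (region st) (flatten (nth [::] (parts st) j))].

Definition next_part (st : state) : seq (seq V) :=
  pick_part (region st) [seq flatten (nth [::] (parts st) j) | j <- touched st].

Definition next_colour (st : state) : nat :=
  fresh [seq nth 0 (colours st) j | j <- touched st].

(** The decomposition followed along the branch of [v]. Once [v] is covered, the region is empty and
    later values are junk. *)
Fixpoint stage n v : state :=
  if n is m.+1 then
    let st := stage m v in
    State (rcons (parts st) (next_part st)) (rcons (colours st) (next_colour st))
      (component (fun x => region st x && (x \notin flatten (next_part st))) v)
  else State [::] [::] (component predT v).

Definition reg n v := region (stage n v).
Definition part n v := next_part (stage n v).
Definition verts n v := flatten (part n v).

Lemma size_parts n v : size (parts (stage n v)) = n.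
Proof. by elim: n => //= n IH; rewrite size_rcons IH. Qed.

Lemma size_colours n v : size (colours (stage n v)) = n.
Proof. by elim: n => //= n IH; rewrite size_rcons IH. Qed.

Lemma nth_parts n v j : j < n -> nth [::] (parts (stage n v)) j = part j v.
Proof.
elim: n => //= n IH; rewrite ltnS leq_eqVlt nth_rcons size_parts => /orP[/eqP ->|jn].
  by rewrite ltnn eqxx.
by rewrite jn IH.
Qed.

Lemma nth_colours n v j : j < n ->
  nth 0 (colours (stage n v)) j = next_colour (stage j v).
Proof.
elim: n => //= n IH; rewrite ltnS leq_eqVlt nth_rcons size_colours => /orP[/eqP ->|jn].
  by rewrite ltnn eqxx.
by rewrite jn IH.
Qed.

Lemma reg_sub i n v : i <= n -> subpred (reg n v) (reg i v).
Proof.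
elim: n => [|n IH]; first by rewrite leqn0 => /eqP ->.
rewrite leq_eqVlt => /orP[/eqP -> //|/IH sub] x /component_sub/andP[/sub].
by [].
Qed.

Lemma reg_notin n v x : reg n.+1 v x -> x \notin verts n v.
Proof. by move=> /component_sub/andP[]. Qed.

(** Every choice is a function of the state, and the state depends on [v] only through its
    components. *)
Lemma stage_eq n v x : reg n v x -> stage n x = stage n v.
Proof.
elim: n => [|n IH] vx; first by congr State; apply: component_eq.
have st := IH (reg_sub (leqnSn n) vx).
by move: vx; rewrite /reg /= st => vx; congr State; apply: component_eq.
Qed.

Lemma stage_eq_le i n v x : i <= n -> reg n v x -> stage i x = stage i v.
Proof. by move=> le /(reg_sub le)/stage_eq. Qed.

Lemma reg_conn n v : conn (reg n v).
Proof. by case: n => [|n]; apply: component_conn. Qed.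

Lemma reg_step n v : reg n v v -> v \notin verts n v -> reg n.+1 v v.
Proof. by move=> vn vN; apply: component_refl; rewrite -/(reg n v) vn. Qed.

Lemma touchedP n v j :
  reflect (j < n /\ touches (reg n v) (verts j v)) (j \in touched (stage n v)).
Proof.
rewrite mem_filter mem_iota size_parts /= add0n andbC.
by case: (ltnP j n) => jn /=; [rewrite nth_parts //; apply: (iffP idP) => [|[]]
  | apply: ReflectF => -[]].
Qed.

Lemma part_good n v : reg n v v ->
  good_part (reg n v) [seq verts j v | j <- touched (stage n v)] (part n v).
Proof.
move=> nv; have -> : [seq verts j v | j <- touched (stage n v)] =
    [seq flatten (nth [::] (parts (stage n v)) j) | j <- touched (stage n v)].
  by apply/eq_in_map => j /touchedP[jn _]; rewrite nth_parts.
apply: pick_partP (@reg_conn n v) nv _ => _ /mapP[j /touchedP[jn jT] ->].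
by rewrite nth_parts.
Qed.

Lemma verts_sub n v x : reg n v v -> x \in verts n v -> reg n v x.
Proof. by move=> /part_good/part_layered/layered_sub; apply. Qed.

Lemma verts_disjoint i j v x : i < j -> reg j v v -> x \in verts j v ->
  x \notin verts i v.
Proof. by move=> ij jv /(verts_sub jv)/(reg_sub ij)/reg_notin. Qed.

(** The larger region present when part [j] was chosen touched part [i] as well, so part [j] was
    built to touch it. *)
Lemma verts_touch i j n v : reg n v v -> i < j -> i \in touched (stage n v) ->
  j \in touched (stage n v) -> touches (fun x => x \in verts j v) (verts i v).
Proof.
move=> nv ij /touchedP[_ niT] /touchedP[jn _].
apply: (part_touches (part_good (reg_sub (ltnW jn) nv))); apply: map_f.
by apply/touchedP; split=> //; apply: touches_sub niT => x; apply: reg_sub (ltnW jn) _.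
Qed.

Lemma verts_root n v : reg n v v -> exists x, x \in verts n v.
Proof.
move=> /part_good/part_layered/layered_neq0; rewrite /verts.
by case: (part n v) => [|[|x P] Q] // _; exists x; apply: mem_head.
Qed.

Lemma touches_sym A X : touches A X ->
  exists x y, [/\ x \in X, A y & E x y].
Proof. by move=> /asboolP[x [y [? ? ?]]]; exists y, x; rewrite adj_sym. Qed.

(* The touched parts together with the region form a complete minor. *)
Lemma size_touched t n v : 0 < t -> ~ has_K_minor G t -> reg n v v ->
  size (touched (stage n v)) < t - 1.
Proof.
move=> t0 noK nv; rewrite ltnNge; apply/negP => le; apply: noK.
set K := touched _ in le *.
have uK : uniq K by rewrite filter_uniq ?iota_uniq.
have KK i : i < t - 1 -> nth 0 K i \in K by move=> it; apply: mem_nth (leq_trans it le).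
have Kreg j : j \in K -> reg j v v.
  by move=> /touchedP[jn _]; exact: (reg_sub (ltnW jn) nv).
pose B (i : 'I_t) x := if i < t - 1 then x \in verts (nth 0 K i) v else reg n v x.
have Kne (i j : 'I_t) : i != j -> i < t - 1 -> j < t - 1 -> nth 0 K i != nth 0 K j.
  by move=> ij it jt; rewrite nth_uniq ?(leq_trans it) ?(leq_trans jt).
have last_eq (i j : 'I_t) : (i < t - 1) = false -> (j < t - 1) = false -> i == j.
  by move=> it jt; rewrite -val_eqE /=; have := ltn_ord i; have := ltn_ord j; lia.
exists (fun i x => B i x); rewrite /B; split.
- by move=> i; case it: (i < t - 1); [apply: verts_root (Kreg _ (KK i it)) | exists v].
- move=> i; case it: (i < t - 1); last exact/conn_connected_set/reg_conn.
  have iv := Kreg _ (KK i it).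
  exact/conn_connected_set/(layered_conn (part_layered (part_good iv))).
- move=> i j x ij; case it: (i < t - 1); case jt: (j < t - 1).
  + move=> xi; apply/negP; move: xi (Kne i j ij it jt) (KK i it) (KK j jt).
    move: (nth 0 K i) (nth 0 K j) => a b xa ab aK bK.
    case: (ltngtP a b) ab => // ab _; last exact: verts_disjoint ab (Kreg _ aK) xa.
    by apply: contraL xa => xb; apply: verts_disjoint ab (Kreg _ bK) xb.
  + move=> xi /reg_sub nx; move: (KK i it) xi => /touchedP[an _] xa.
    by have := reg_notin (nx _ an); rewrite xa.
  + move=> /reg_sub nx; move: (KK j jt) => /touchedP[an _].
    by have := reg_notin (nx _ an) => /negP.
  + by case/negP: ij; rewrite last_eq.
move=> i j ij; case it: (i < t - 1); case jt: (j < t - 1).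
- have := Kne i j ij it jt; have := KK i it; have := KK j jt.
  move: (nth 0 K i) (nth 0 K j) => a b bK aK ab.
  case: (ltngtP a b) ab => // ab _; last exact/asboolP/(verts_touch nv ab bK aK).
  by have /touches_sym := verts_touch nv ab aK bK.
- by have /touchedP[_ /touches_sym] := KK i it.
- by have /touchedP[_ /asboolP] := KK j jt.
by case/negP: ij; rewrite last_eq.
Qed.

Lemma reg_uncovered n v : (forall i, i < n -> v \notin verts i v) -> reg n v v.
Proof.
elim: n => [|n IH] vN; first exact: component_refl.
by apply: reg_step (vN n (ltnSn n)); apply: IH => i /ltnW; apply: vN.
Qed.

(* If [v] were never covered, an edge leaving the intersection of its regions
   would provide a permanent boundary vertex [x], and every later part would
   contain a vertex that is no later than [x] in the enumeration. *)
Lemma covered v : exists n, v \in verts n v.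
Proof.
apply: contrapT => none.
have vreg n : reg n v v.
  by apply: reg_uncovered => i _; apply/negP => vi; apply: none; exists i.
pose R : pred V := fun x => `[< forall n, reg n v x >].
have [r r0] := verts_root (vreg 0).
have Rr : ~~ R r by apply/asboolPn => /(_ 1)/reg_notin; rewrite r0.
have Rv : R v by apply/asboolP.
have [p [pp pr _]] : reach predT v r by apply/asboolP; apply: verts_sub r0.
have [|x [y [_ _ xy]]] := path_crossing (D := R) pp; first by rewrite pr Rv (negPf Rr).
rewrite pr Rv (negPf Rr) => /asboolP Rx /asboolPn Ry.
have [m my] : exists m, y \in verts m v.
  apply: contrapT => noy; apply: Ry; elim=> [|n IH]; first exact: component_edge (Rx 0) _ xy.
  apply: component_edge (Rx n.+1) _ xy; rewrite -/(reg n v) IH.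
  by apply/negP => ny; apply: noy; exists n.
have low n : exists z, m < n -> z \in verts n v /\ pickle z <= pickle x.
  case: (ltnP m n) => mn; last by exists v.
  have xm : touches (pred1 x) (verts m v) by apply/asboolP; exists x, y; rewrite /= eqxx.
  have [|z zn zx] := part_least (part_good (vreg n)) _ (Rx n) xm; last by exists z.
  apply: map_f; apply/touchedP; split=> //.
  by apply: touches_sub xm => _ /eqP ->; apply: Rx.
have [z zP] := choice low.
(* Pigeonhole: [pickle x + 2] disjoint parts would each contain a vertex numbered at most
   [pickle x]. *)
have : size (iota m.+1 (pickle x).+2) <= (pickle x).+1.
  apply: (@size_by_window _ (fun n => pickle (z n)) _ 0); first exact: iota_uniq.
    move=> i j; rewrite !mem_iota => /andP[/zP[zi _] _] /andP[/zP[zj _] _].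
    move/(pcan_inj pickleK) => zij; rewrite -zij in zj.
    case: (ltngtP i j) => // ij; first by have := verts_disjoint ij (vreg j) zj; rewrite zi.
    by have := verts_disjoint ij (vreg i) zi; rewrite zj.
  by move=> n; rewrite mem_iota => /andP[/zP[_ zx] _].
by rewrite size_iota ltnn.
Qed.

(** * Ranks and the tree order *)

Definition rank v := ex_minn (covered v).

Lemma rank_mem v : v \in verts (rank v) v.
Proof. by rewrite /rank; case: ex_minnP. Qed.

Lemma rank_reg n v : n <= rank v -> reg n v v.
Proof.
move=> nv; apply: reg_uncovered => i ni; rewrite /rank in nv *.
case: ex_minnP nv => m _ min nm; apply: contraTN (leq_trans ni nm).
by move=> /min; rewrite -leqNgt.
Qed.

Lemma rank_eq n v x : n <= rank v -> x \in verts n v -> rank x = n.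
Proof.
move=> nv xn; have xreg := verts_sub (rank_reg nv) xn.
have st i : i <= n -> stage i x = stage i v by move=> /stage_eq_le; apply.
have xn' : x \in verts n x by rewrite /verts /part st.
rewrite /rank; case: ex_minnP => m xm min; apply/eqP; rewrite eqn_leq min //=.
rewrite leqNgt; apply/negP => mn; move: xm; rewrite /verts /part st ?(ltnW mn) //.
by apply/negP; apply: verts_disjoint mn (rank_reg nv) xn.
Qed.

(* [x] comes before [y] on a branch of the tree order underlying the decomposition. *)
Definition before x y :=
  [/\ reg (rank x) y x, rank x <= rank y &
    rank x = rank y -> index x (verts (rank x) x) < index y (verts (rank x) x)].

Lemma before_stage i x y : before x y -> i <= rank x -> stage i x = stage i y.
Proof. by case=> xy _ _ /stage_eq_le; apply. Qed.

Lemma before_mem x y : before x y -> x \in verts (rank x) y.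
Proof. by move=> /before_stage/(_ (leqnn _)) st; rewrite /verts /part -st rank_mem. Qed.

Definition full n v := flatten [seq verts j v | j <- iota 0 n].

(** The branch up to and including [v], in order; its labels form the code of [v]. *)
Definition chain v :=
  full (rank v) v ++ take (index v (verts (rank v) v)).+1 (verts (rank v) v).

Lemma fullS n v : full n.+1 v = full n v ++ verts n v.
Proof. by rewrite /full -addn1 iotaD map_cat flatten_cat /= cats0. Qed.

Lemma full_memP n v x :
  reflect (exists2 i, i < n & x \in verts i v) (x \in full n v).
Proof.
apply: (iffP flatten_mapP) => -[i]; last by exists i; rewrite ?mem_iota.
by rewrite mem_iota => ? ?; exists i.
Qed.

Lemma full_eq n x y : (forall i, i < n -> stage i x = stage i y) -> full n x = full n y.
Proof.
move=> st; congr flatten; apply/eq_in_map => i; rewrite mem_iota => /st.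
by rewrite /verts /part => ->.
Qed.

Lemma verts_before n v x y : n <= rank v -> x \in verts n v -> y \in verts n v ->
  index x (verts n v) < index y (verts n v) -> before x y.
Proof.
move=> nv xn yn xy; have rx := rank_eq nv xn; have ry := rank_eq nv yn.
have xreg := verts_sub (rank_reg nv) xn; have yreg := verts_sub (rank_reg nv) yn.
split; rewrite rx ?ry //; first by rewrite /reg (stage_eq yreg).
by rewrite /verts /part (stage_eq xreg).
Qed.

Lemma verts_before_lt i n v x y : i < n -> n <= rank v ->
  x \in verts i v -> y \in verts n v -> before x y.
Proof.
move=> ni nv xi yn; have iv := leq_trans (ltnW ni) nv.
have rx := rank_eq iv xi; have ry := rank_eq nv yn.
have yreg := verts_sub (rank_reg nv) yn.
have xreg := verts_sub (rank_reg iv) xi.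
split; rewrite rx ?ry ?(ltnW ni) //; last by move=> e; rewrite e ltnn in ni.
by rewrite /reg (stage_eq_le (ltnW ni) yreg).
Qed.

Lemma verts_uniq n v : reg n v v -> uniq (verts n v).
Proof. by move=> /part_good/part_layered/layered_uniq. Qed.

Lemma pairwise_index (T : eqType) (s : seq T) : uniq s ->
  pairwise (fun a b => index a s < index b s) s.
Proof.
move=> us; case: s us => // x0 s us; apply/(pairwiseP x0) => i j si sj ij.
by rewrite !index_uniq.
Qed.

Lemma full_pairwise n v : n <= (rank v).+1 ->
  pairwise (fun x y => `[< before x y >]) (full n v).
Proof.
elim: n => // n IH nv; rewrite fullS pairwise_cat (IH (ltnW nv)) /=.
apply/andP; split.
  apply/allrelP => x y /full_memP[i ni xi] yn.
  exact/asboolP/(verts_before_lt ni nv xi yn).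
have := pairwise_index (verts_uniq (rank_reg nv)).
apply: (sub_in_pairwise (P := mem (verts n v))); last exact/allP.
move=> x y xn yn /= xy; apply/asboolP; exact: verts_before xy.
Qed.

Lemma chain_pairwise v : pairwise (fun x y => `[< before x y >]) (chain v).
Proof.
have := full_pairwise (leqnn (rank v).+1).
rewrite fullS -{1}(cat_take_drop (index v (verts (rank v) v)).+1 (verts _ _)) catA.
by rewrite pairwise_cat => /and3P[].
Qed.

Lemma last_chain x0 v : last x0 (chain v) = v.
Proof.
rewrite /chain last_cat (take_nth v) ?index_mem ?rank_mem //.
by rewrite last_rcons nth_index ?rank_mem.
Qed.

Lemma chain_neq0 v : chain v != [::].
Proof.
rewrite /chain; have := rank_mem v; case: (verts _ _) => // x s _.
by rewrite -size_eq0 size_cat /= addnS.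
Qed.

(** Both vertices have the same stages up to [rank x], so their chains agree up to [x]. *)
Lemma before_chain x y : before x y -> exists2 s, chain y = chain x ++ s & s != [::].
Proof.
move=> xy; have [_ le idx] := xy; have st i := before_stage (i := i) xy.
have fE n : n <= rank x -> full n x = full n y.
  by move=> nx; apply: full_eq => i ni; rewrite st // ltnW // (leq_trans ni).
have vE : verts (rank x) x = verts (rank x) y by rewrite /verts /part st.
move: le; rewrite leq_eqVlt => /orP[/eqP rxy|rxy].
  have {}idx := idx rxy; rewrite /chain -rxy fE // -vE.
  set a := index x _ in idx *; set b := index y _ in idx *; set S := verts _ _.
  exists (drop a.+1 (take b.+1 S)).
    rewrite -catA; congr cat.
    by rewrite -{1}(cat_take_drop a.+1 (take _ _)) take_takel // ltnS ltnW.
  have bS : b < size S by rewrite index_mem /S vE rxy rank_mem.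
  by rewrite -size_eq0 size_drop size_takel //; lia.
pose a := (index x (verts (rank x) x)).+1.
have [l lE] : exists l, full (rank y) y = full (rank x).+1 y ++ l.
  exists (flatten [seq verts j y | j <- iota (rank x).+1 (rank y - (rank x).+1)]).
  by rewrite /full -flatten_cat -map_cat -{1}[(rank x).+1]add0n -iotaD subnKC.
exists (drop a (verts (rank x) x) ++ l ++ take (index y (verts (rank y) y)).+1 (verts (rank y) y)).
  rewrite /chain lE fullS -fE // -vE -!catA; congr cat.
  by rewrite [RHS]catA cat_take_drop.
have := rank_mem y; case: (verts (rank y) y) => // z s _.
by rewrite -size_eq0 !size_cat /= !addnS.
Qed.

Lemma before_mem_chain x y : before x y -> x \in chain y.
Proof.
case/before_chain=> s -> _; rewrite mem_cat -{1}(last_chain x x).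
have := chain_neq0 x; case: (chain x) => // a l _ /=.
by rewrite mem_last.
Qed.

(** While neither end is covered, an edge keeps both ends in one component. *)
Lemma edge_reg n x y : E x y -> n <= rank x -> n <= rank y -> reg n x y.
Proof.
move=> xy; elim: n => [|n IH] nx ny.
  by apply: component_edge xy => //; apply: component_refl.
have xyn := IH (ltnW nx) (ltnW ny).
apply: component_edge (xy); first exact: rank_reg nx.
rewrite -/(reg n x) xyn; have := reg_notin (rank_reg ny).
by rewrite /verts /part (stage_eq xyn).
Qed.

Lemma edge_before x y : E x y -> rank x <= rank y -> before x y \/ before y x.
Proof.
move=> xy le; have regxy := edge_reg xy (leqnn _) le.
have st := stage_eq regxy.
have regyx : reg (rank x) y x by rewrite /reg st; apply: rank_reg.
case: (eqVneq (rank x) (rank y)) => [rxy|ne]; last first.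
  by left; split=> // e; rewrite e eqxx in ne.
have vE : verts (rank x) x = verts (rank y) y by rewrite /verts /part -rxy st.
case: (ltngtP (index x (verts (rank x) x)) (index y (verts (rank x) x))) => idx.
- by left.
- by right; split; [rewrite -rxy | rewrite -rxy | rewrite -vE].
have e : x = y.
  rewrite -(nth_index x (rank_mem x)) idx nth_index // vE; exact: rank_mem.
by rewrite e adj_irr in xy.
Qed.

Lemma edge_before_or x y : E x y -> before x y \/ before y x.
Proof.
move=> xy; case: (leqP (rank x) (rank y)) => [|/ltnW]; first exact: edge_before.
by rewrite adj_sym in xy => /(edge_before xy)[]; [right|left].
Qed.

(** * The embedding *)

Section Embedding.
Variable t : nat.
Hypothesis t3 : 3 <= t.
Hypothesis noK : ~ has_K_minor G t.

Definition path_index x := find (fun P => x \in P) (part (rank x) x).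

Definition part_dist j s x := gdist (reg j x) (flatten (take s (part j x))) x.

(** The enumeration number as [lid] makes the code injective and lets [lnbr] name neighbours.
    [lrest] counts the vertices of the part from [x] on. *)
Definition vertex_label x := Label (pickle x) (rank x) (path_index x)
  (size (verts (rank x) x) - index x (verts (rank x) x))
  (next_colour (stage (rank x) x)) (touched (stage (rank x) x))
  [seq pickle y | y <- chain x & E x y]
  [seq [seq part_dist j s x | s <- iota 0 (t - 2)] | j <- iota 0 (rank x).+1].

Lemma dist_label x j s : j <= rank x ->
  dist (vertex_label x) j s = if s < t - 2 then part_dist j s x else 0.
Proof.
move=> jx; rewrite /dist.
rewrite -[ldist _]/[seq [seq part_dist i k x | k <- iota 0 (t - 2)] | i <- iota 0 (rank x).+1].
rewrite (nth_map 0) ?size_iota // nth_iota // add0n.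
case: ltnP => st; first by rewrite (nth_map 0) ?size_iota // nth_iota.
by rewrite nth_default // size_map size_iota.
Qed.

Lemma has_path_index x : has (fun P => x \in P) (part (rank x) x).
Proof. by apply/hasP; have /flattenP[P ? ?] := rank_mem x; exists P. Qed.

(** Distance 0 to a nonempty set means membership, and a vertex of a later part lies on no path of
    part [j]. *)
Lemma part_dist_gt0 j s x : j <= rank x ->
  (0 < part_dist j s x) = (0 < s) && ((j < rank x) || (s <= path_index x)).
Proof.
move=> jx; have lQ := part_layered (part_good (rank_reg jx)).
case: s => [|s].
  by rewrite /part_dist take0 gdist_nil.
have Q0 := layered_take_neq0 lQ (ltn0Sn s).
have sQ : {subset flatten (take s.+1 (part j x)) <= reg j x}.
  move=> y yQ; apply: (layered_sub lQ); rewrite -(cat_take_drop s.+1 (part j x)).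
  by rewrite flatten_cat mem_cat yQ.
rewrite lt0n /part_dist (gdist_eq0 (@reg_conn j x) sQ Q0 (rank_reg jx)) /=.
move: jx; rewrite leq_eqVlt => /orP[/eqP je|jx].
  rewrite je ltnn /= ltnNge -ltnS -/(path_index x); congr negb.
  rewrite -(has_take _ (has_path_index x)); apply/flattenP/hasP => -[P ? ?]; by exists P.
rewrite jx; apply/negP => xQ.
have := verts_disjoint jx (rank_reg (leqnn _)) (rank_mem x); apply/negP/negPn.
by rewrite /verts -(cat_take_drop s.+1 (part j x)) flatten_cat mem_cat xQ.
Qed.

(** Without a [K_t] minor at most [t - 2] parts are touched. This bounds the number of paths by
    [maxn 1 (t - 2)], which is [t - 2], and the greedy colour by [t - 2]. *)
Lemma good_vertex_label x : good t (vertex_label x).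
Proof.
have K := size_touched (ltnW (ltnW t3)) noK (rank_reg (leqnn (rank x))).
split.
- by rewrite /=; lia.
- have := part_size (part_good (rank_reg (leqnn (rank x)))); rewrite size_map.
  have := has_path_index x; rewrite has_find /= -/(path_index x); move: K t3.
  by rewrite /maxn; case: ifP; lia.
- rewrite /= /next_colour; set us := [seq nth 0 _ j | j <- _].
  by have [le _] := fresh_le us; rewrite size_map in le; lia.
by move=> j s st jx; rewrite dist_label // st part_dist_gt0.
Qed.

(** The stages of [x] and [y] coincide up to [rank x], so both labels refer to the same parts,
    regions and distances. *)
Lemma compat_vertex_label x y : before x y -> compat (vertex_label x) (vertex_label y).
Proof.
move=> xy; have [regx le idx] := xy; have st i := before_stage (i := i) xy.
have edge : lid (vertex_label x) \in lnbr (vertex_label y) -> E x y.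
  case/mapP=> z; rewrite mem_filter => /andP[yz _] /(pcan_inj pickleK) ->.
  by rewrite adj_sym.
have partE : rank x = rank y -> part (rank y) y = part (rank x) x.
  by move=> <-; rewrite /part (st _ (leqnn _)).
have distE j s : j <= rank x ->
    part_dist j s y = gdist (reg j x) (flatten (take s (part j x))) y.
  by move=> jx; rewrite /part_dist /reg /part (st _ jx).
split=> //=.
- move=> e; have := idx e; have := rank_mem y.
  have -> : verts (rank y) y = verts (rank x) x by rewrite /verts partE.
  by rewrite -index_mem; move: (size _) (index _ _) (index _ _) => m i j; lia.
- move=> e; rewrite /layer /= => pe; have yE := partE e.
  rewrite !dist_label // -pe; have := good_path (good_vertex_label x) => /= ->.
  rewrite -e distE // /part_dist => de.
  have lQ := part_layered (part_good (rank_reg (leqnn (rank x)))).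
  suff exy : x = y by have := idx e; rewrite exy ltnn.
  apply: (layered_inj lQ _ _ de); first exact: (nth_find [::] (has_path_index x)).
  by rewrite pe -yE; apply: (nth_find [::] (has_path_index y)).
- move=> q /touchedP[_ qT] qx; apply/touchedP; split=> //.
  rewrite /reg /verts /part !st // ?(ltnW qx) //.
  by apply: touches_sub qT => z; apply: reg_sub le _.
- move=> /edge exy ne; have lt : rank x < rank y by rewrite ltn_neqAle ne.
  have xT : rank x \in touched (stage (rank y) y).
    apply/touchedP; split=> //; apply/asboolP; exists y, x.
    by rewrite adj_sym exy before_mem //; split=> //; apply: rank_reg.
  rewrite xT /= st // -(nth_colours y lt) /next_colour.
  set us := [seq nth 0 (colours (stage (rank y) y)) j | j <- _].
  (* The greedy colour of the part of [y] avoids those of all touched parts, that of [x]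
     included. *)
  have [_ fN] := fresh_le us; apply: contraNneq fN => <-; exact: map_f.
move=> /edge exy j s jx; rewrite !dist_label ?(leq_trans jx) //.
case: ifP => // _; rewrite distE // /part_dist.
have xj : reg j x x by apply: rank_reg.
have yj : reg j x y by rewrite /reg st //; apply: rank_reg; apply: leq_trans le.
have eyx : E y x by rewrite adj_sym.
by split; apply: gdist_lipschitz.
Qed.

Definition embedding x : seq label := map vertex_label (chain x).

Lemma valid_embedding x : valid t (embedding x).
Proof.
apply/andP; split.
  by apply/allP => _ /mapP[y _ ->]; apply/asboolP/good_vertex_label.
rewrite pairwise_map; apply: sub_pairwise (chain_pairwise x) => u w /asboolP uw.
exact/asboolP/compat_vertex_label.
Qed.

Lemma tip_embedding x : tip (embedding x) = vertex_label x.
Proof.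
rewrite /tip /embedding; have := chain_neq0 x; case E : (chain x) => [|a l] // _.
by rewrite /= last_map -(last_chain x x) E.
Qed.

Lemma below_embedding x y : before x y -> below t (embedding x) (embedding y).
Proof.
move=> xy; rewrite /below valid_embedding /embedding.
have [s -> s0] := before_chain xy.
rewrite map_cat prefix_prefix andbT size_cat -[X in X < _]addn0 ltn_add2l.
by rewrite lt0n -!size_eq0 !size_map !size_eq0 chain_neq0 s0.
Qed.

Lemma up_adj_embedding x y : before x y -> E x y -> up_adj t (embedding x) (embedding y).
Proof.
move=> xy exy; rewrite /up_adj below_embedding // !tip_embedding /=.
by apply: map_f; rewrite mem_filter adj_sym exy before_mem_chain.
Qed.

Lemma up_adj_embedding_edge x y : up_adj t (embedding x) (embedding y) -> E x y.
Proof.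
case/andP=> _; rewrite !tip_embedding /= => /mapP[z].
by rewrite mem_filter => /andP[yz _] /(pcan_inj pickleK) ->; rewrite adj_sym.
Qed.

Lemma embedding_inj : injective embedding.
Proof.
move=> x y /(congr1 (fun c => lid (tip c))); rewrite !tip_embedding.
exact: (pcan_inj pickleK).
Qed.

(** Edges join comparable vertices, and [lnbr] records exactly the adjacent predecessors, so
    adjacency is preserved and reflected. *)
Lemma minor_free_induced : induced_sub G (universal t).
Proof.
exists embedding; split=> [|x y]; first exact: embedding_inj.
apply/idP/idP => [/orP[/up_adj_embedding_edge //|/up_adj_embedding_edge]|xy].
  by rewrite adj_sym.
apply/orP; case: (edge_before_or xy) => b; [left|right]; apply: up_adj_embedding => //.
by rewrite adj_sym.
Qed.

End Embedding.
End Decomposition.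

Theorem mainTheorem3 (t : nat) : 3 <= t ->
  exists U : sgraph,
    [/\ forall G : sgraph, ~ has_K_minor G t -> induced_sub G U,
        ~ has_subdiv_K_aleph0 U,
        colourable U ((t - 1) ^ 2),
        finite_subgraphs_have_low_degree U ((t - 2) * (2 * t - 3)) &
        forall r : nat, col_le U r ((t - 2) * (t - 1) * (2 * r + 1)) ].
Proof.
move=> t3; exists (universal t); split.
- by move=> G noK; apply: minor_free_induced.
- exact: universal_no_subdivision.
- exact: universal_colourable.
- exact: universal_low_degree.
exact: universal_col.
Qed.
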